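(* Let $n,d\in\mathbb N$. Let $(A,B,E,\mathrm{tr}_B)$ be a left Gabor bimodule, and assume in addition that $A$ is unital. Let $\mathrm{tr}_A$ be the trace on $A$ induced by $\mathrm{tr}_B$. If $g\in M_{n,d}(E)$ is such that the frame operator $\Theta_g:M_{n,d}(E)\to M_{n,d}(E)$, $\Theta_g f={}_\bullet[f,g]\,g$, is invertible, then $$d\,\mathrm{tr}_B(1_B)\le n\,\mathrm{tr}_A(1_A).$$
   Context: An $A$-$B$-equivalence bimodule is an $A$-$B$-bimodule $E$ that is a left Hilbert $A$-module with inner product ${}_\bullet\langle\cdot,\cdot\rangle$ (linear in the first variable) and a right Hilbert $B$-module with inner product $\langle\cdot,\cdot\rangle_\bullet$ (linear in the second variable) such that: (i) the linear span of $\{{}_\bullet\langle f,g\rangle\}$ is dense in $A$ and that of $\{\langle f,g\rangle_\bullet\}$ is dense in $B$; (ii) $\langle af,g\rangle_\bullet=\langle f,a^*g\rangle_\bullet$ and ${}_\bullet\langle fb,g\rangle={}_\bullet\langle f,gb^*\rangle$; (iii) ${}_\bullet\langle f,g\rangle h=f\langle g,h\rangle_\bullet$, for all $f,g,h\in E$, $a\in A$, $b\in B$. A left Gabor bimodule is a quadruple $(A,B,E,\mathrm{tr}_B)$ where $A,B$ are $C^*$-algebras, $B$ is unital, $\mathrm{tr}_B$ is a faithful finite (positive) trace on $B$, and $E$ is an $A$-$B$-equivalence bimodule. The induced trace $\mathrm{tr}_A$ is the unique lower semicontinuous trace on $A$ with $\mathrm{tr}_A({}_\bullet\langle f,g\rangle)=\mathrm{tr}_B(\langle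 g,f\rangle_\bullet)$ for all $f,g\in E$; it is finite when $A$ is unital. No normalization of the traces is assumed. $M_{n,d}(E)$ is the space of $n\times d$ matrices over $E$, with rows indexed by $\mathbb Z_n=\mathbb Z/n\mathbb Z$ and columns by $\mathbb Z_d$. It is an $M_n(A)$-$M_d(B)$-equivalence bimodule for the actions $(af)_{i,j}=\sum_{k\in\mathbb Z_n}a_{i,k}f_{k,j}$, $(fb)_{i,j}=\sum_{k\in\mathbb Z_d}f_{i,k}b_{k,j}$ and inner products ${}_\bullet[f,g]_{i,j}=\sum_{k\in\mathbb Z_d}{}_\bullet\langle f_{i,k},g_{j,k}\rangle$ (in $M_n(A)$) and $([f,g]_\bullet)_{i,j}=\sum_{k\in\mathbb Z_n}\langle f_{k,i},g_{k,j}\rangle_\bullet$ (in $M_d(B)$). *)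

(* Defs.v *)
From HB Require Import structures.
From mathcomp Require Import all_boot all_order all_algebra.
From mathcomp Require Import complex.
From mathcomp Require Import all_classical all_reals all_analysis.

Set Implicit Arguments.
Unset Strict Implicit.
Unset Printing Implicit Defensive.

Import Order.TTheory GRing.Theory Num.Theory.

Local Open Scope classical_set_scope.
Local Open Scope ring_scope.

(* C*-algebras over R[i], not necessarily unital; the norm of a
   completeNormedModType R[i] takes its values in R[i]. *)
HB.mixin Record CompleteNormedModule_isCStarAlgebra (R : realType) A
    & CompleteNormedModule R[i] A := {
  cmul : A -> A -> A ;
  cstar : A -> A ;
  cmulA : associative cmul ;
  cmulDl : left_distributive cmul +%R ;
  cmulDr : right_distributive cmul +%R ;
  cmulZl : forall (k : R[i]) (a b : A), cmul (k *: a) b = k *: cmul a b ;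
  cmulZr : forall (k : R[i]) (a b : A), cmul a (k *: b) = k *: cmul a b ;
  cstarK : involutive cstar ;
  cstarD : forall a b : A, cstar (a + b) = cstar a + cstar b ;
  cstarZ : forall (k : R[i]) (a : A), cstar (k *: a) = k^* *: cstar a ;
  cstarM : forall a b : A, cstar (cmul a b) = cmul (cstar b) (cstar a) ;
  ler_cnormM : forall a b : A, `|cmul a b| <= `|a| * `|b| ;
  cnorm_starM : forall a : A, `|cmul (cstar a) a| = `|a| ^+ 2
}.

#[short(type="cstarType")]
HB.structure Definition CStarAlgebra (R : realType) :=
  {A of CompleteNormedModule_isCStarAlgebra R A & CompleteNormedModule R[i] A}.

Definition is_identity (R : realType) (A : cstarType R) (e : A) : Prop :=
  forall a : A, cmul e a = a /\ cmul a e = a.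

Definition cpos (R : realType) (A : cstarType R) (a : A) : Prop :=
  exists x : A, a = cmul (cstar x) x.

Definition linear_span (K : pzRingType) (V : lmodType K) (S : set V) : set V :=
  [set v | exists (k : nat) (c : 'I_k -> K) (s : 'I_k -> V),
             (forall i, S (s i)) /\ v = \sum_(i < k) c i *: s i].

Definition ip_norm (R : realType) (A : cstarType R) (E : lmodType R[i])
  (ip : E -> E -> A) (f : E) : R[i] := sqrtC `|ip f f|.

Definition ip_complete (R : realType) (A : cstarType R) (E : lmodType R[i])
    (ip : E -> E -> A) : Prop :=
  forall u : nat -> E,
    (forall e : R[i], 0 < e -> exists N : nat, forall p q : nat,
       (N <= p)%N -> (N <= q)%N -> ip_norm ip (u p - u q) < e) ->
    exists l : E, forall e : R[i], 0 < e -> exists N : nat, forall p : nat,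
       (N <= p)%N -> ip_norm ip (u p - l) < e.

Record is_left_hilbert_module (R : realType) (A : cstarType R)
    (E : lmodType R[i]) (act : A -> E -> E) (ip : E -> E -> A) : Prop := {
  lactDl : forall a b f, act (a + b) f = act a f + act b f ;
  lactDr : forall a f g, act a (f + g) = act a f + act a g ;
  lactZl : forall (k : R[i]) a f, act (k *: a) f = k *: act a f ;
  lactZr : forall (k : R[i]) a f, act a (k *: f) = k *: act a f ;
  lactM : forall a b f, act (cmul a b) f = act a (act b f) ;
  lipD : forall f g h, ip (f + g) h = ip f h + ip g h ;
  lipZ : forall (k : R[i]) f g, ip (k *: f) g = k *: ip f g ;
  lip_act : forall a f g, ip (act a f) g = cmul a (ip f g) ;
  lip_star : forall f g, cstar (ip f g) = ip g f ;
  lip_pos : forall f, cpos (ip f f) ;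
  lip_def : forall f, ip f f = 0 -> f = 0 ;
  lip_complete : ip_complete ip
}.

Record is_right_hilbert_module (R : realType) (B : cstarType R)
    (E : lmodType R[i]) (act : E -> B -> E) (ip : E -> E -> B) : Prop := {
  ractDl : forall f g b, act (f + g) b = act f b + act g b ;
  ractDr : forall f a b, act f (a + b) = act f a + act f b ;
  ractZl : forall (k : R[i]) f b, act (k *: f) b = k *: act f b ;
  ractZr : forall (k : R[i]) f b, act f (k *: b) = k *: act f b ;
  ractM : forall f a b, act f (cmul a b) = act (act f a) b ;
  ripD : forall f g h, ip f (g + h) = ip f g + ip f h ;
  ripZ : forall (k : R[i]) f g, ip f (k *: g) = k *: ip f g ;
  rip_act : forall f g b, ip f (act g b) = cmul (ip f g) b ;
  rip_star : forall f g, cstar (ip f g) = ip g f ;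
  rip_pos : forall f, cpos (ip f f) ;
  rip_def : forall f, ip f f = 0 -> f = 0 ;
  rip_complete : ip_complete ip
}.

Record equivalence_bimodule (R : realType) (A B : cstarType R) := {
  eb_sort :> lmodType R[i] ;
  lact : A -> eb_sort -> eb_sort ;
  ract : eb_sort -> B -> eb_sort ;
  lip : eb_sort -> eb_sort -> A ;
  rip : eb_sort -> eb_sort -> B ;
  lractA : forall a f b, ract (lact a f) b = lact a (ract f b) ;
  eb_left : is_left_hilbert_module lact lip ;
  eb_right : is_right_hilbert_module ract rip ;
  lip_full : dense (linear_span [set a | exists f g, a = lip f g]) ;
  rip_full : dense (linear_span [set b | exists f g, b = rip f g]) ;
  rip_lact : forall a f g, rip (lact a f) g = rip f (lact (cstar a) g) ;
  lip_ract : forall f g b, lip (ract f b) g = lip f (ract g (cstar b)) ;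
  lip_rip : forall f g h, lact (lip f g) h = ract f (rip g h)
}.

Record is_faithful_finite_trace (R : realType) (B : cstarType R)
    (tr : B -> R[i]) : Prop := {
  ftrD : forall a b, tr (a + b) = tr a + tr b ;
  ftrZ : forall (k : R[i]) a, tr (k *: a) = k * tr a ;
  ftr_ge0 : forall a, cpos a -> 0 <= tr a ;
  ftrC : forall a b, tr (cmul a b) = tr (cmul b a) ;
  ftr_faithful : forall a, cpos a -> tr a = 0 -> a = 0
}.

Record left_gabor_bimodule (R : realType) := {
  gbA : cstarType R ;
  gbB : cstarType R ;
  gbE : equivalence_bimodule gbA gbB ;
  gb1B : gbB ;
  gb1BP : is_identity gb1B ;
  gb_trB : gbB -> R[i] ;
  gb_trBP : is_faithful_finite_trace gb_trB
}.

(* A trace on A is a map from the positive cone to [0, +oo]; only the values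
   of tau on cpos matter.  Additivity is stated for finite families because
   stability of cpos under sums is a theorem about cstarType rather than part
   of the definition of cpos. *)
Record is_lsc_trace (R : realType) (A : cstarType R) (tau : A -> \bar R)
    : Prop := {
  tr_ge0 : forall a, cpos a -> (0 <= tau a)%E ;
  tr_sum : forall (k : nat) (a : 'I_k -> A), (forall i, cpos (a i)) ->
    tau (\sum_(i < k) a i) = (\sum_(i < k) tau (a i))%E ;
  trZ : forall (r : R) a, 0 <= r -> cpos a ->
    tau ((r%:C)%C *: a) = (r%:E * tau a)%E ;
  tr_starC : forall x, tau (cmul (cstar x) x) = tau (cmul x (cstar x)) ;
  tr_lsc : forall a (t : R), cpos a -> (t%:E < tau a)%E ->
    \forall y \near a, cpos y -> (t%:E < tau y)%E
}.

(* The linear extension of tau to the span of {a >= 0 | tau a < +oo}: a lies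
   in that span and the extension takes the value z at a. *)
Definition tr_ext (R : realType) (A : cstarType R) (tau : A -> \bar R)
    (a : A) (z : R[i]) : Prop :=
  exists p : 'I_4 -> A,
    [/\ forall i, cpos (p i) /\ (tau (p i) < +oo)%E,
        a = \sum_(i < 4) 'i ^+ i *: p i
      & z = \sum_(i < 4) 'i ^+ i * ((fine (tau (p i)))%:C)%C].

Definition is_induced_trace (R : realType) (G : left_gabor_bimodule R)
    (trA : gbA G -> \bar R) : Prop :=
  is_lsc_trace trA /\
  forall f g : gbE G, tr_ext trA (lip f g) (gb_trB (rip g f)).

Definition mx_lact (R : realType) (A B : cstarType R)
    (E : equivalence_bimodule A B) (n d : nat)
    (a : 'M[A]_n) (f : 'M[E]_(n, d)) : 'M[E]_(n, d) :=
  \matrix_(i < n, j < d) \sum_(k < n) lact (a i k) (f k j).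

Definition mx_lip (R : realType) (A B : cstarType R)
    (E : equivalence_bimodule A B) (n d : nat)
    (f g : 'M[E]_(n, d)) : 'M[A]_n :=
  \matrix_(i < n, j < n) \sum_(k < d) lip (f i k) (g j k).

Definition frame_operator (R : realType) (A B : cstarType R)
    (E : equivalence_bimodule A B) (n d : nat)
    (g f : 'M[E]_(n, d)) : 'M[E]_(n, d) :=
  mx_lact (mx_lip f g) g.

(* Main.v *)
Require Import Defs.
From mathcomp Require Import all_boot all_order all_algebra.
From mathcomp Require Import complex.
From mathcomp Require Import all_classical all_reals all_analysis.

Import Order.TTheory GRing.Theory Num.Theory.

Local Open Scope ring_scope.

(** Write [f, g] for the M_n(A)-valued inner product and [f, g]' for the
    M_d(B)-valued one, so that the frame operator of g is f |-> [f, g] g, which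
    is also f |-> f [g, g]'.  In the second form it visibly commutes with the
    action of M_n(A).  Let h be the canonical dual window, the preimage of g
    under the frame operator.  The frame operator maps both [f, g] h and f to
    [f, g] g, so injectivity gives the reconstruction formula
    f = [f, g] h = f [g, h]' ([dual_window_reconstruction]).  Since E is full
    over B, this forces [g, h]' to be the identity of M_d(B);
    [dual_window_biorthogonal] gives its diagonal entries, the only ones that
    the trace sees.

    On the other side put p = [g, h].  Substituting g = [h, g] g in the first
    argument gives p = [h, g] [g, h] = p^* p, so p is a self-adjoint projection
    in M_n(A) ([dual_window_lip_projection]).  Its trace is that of [h, g]',
    namely d tr_B(1_B), and it is at most the trace n tr_A(1_A) of the identity
    because 1 - p is again a projection.

    The traces on matrix algebras enter through diagonal entries only.  For
    every i, the identity of A is the sum of the (i, i) entries of p^* p and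
    (1 - p)^* (1 - p), that is, of explicit elements of the form x^* x
    ([identity_sum_projection]), and tr_A is additive on such finite families.
    The traces of the entries of p are given by the linear extension of tr_A to
    combinations of positive elements of finite trace; [tr_ext_sum] shows that
    this extension agrees with tr_A on sums of positive elements. *)

(** * Additive maps and the algebra of a C*-algebra *)

Section MorphSum.
Variables (U V : zmodType) (f : U -> V).
Hypothesis fD : forall x y, f (x + y) = f x + f y.

Lemma morphD0 : f 0 = 0.
Proof. by apply: (addrI (f 0)); rewrite -fD !addr0. Qed.

Lemma morphDN x : f (- x) = - f x.
Proof. by apply: (addrI (f x)); rewrite -fD !subrr morphD0. Qed.

Lemma morphD_sum (I : Type) (r : seq I) (P : pred I) (F : I -> U) :
  f (\sum_(i <- r | P i) F i) = \sum_(i <- r | P i) f (F i).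
Proof. exact: (big_morph f fD morphD0). Qed.
End MorphSum.

Section CStar.
Context {R : realType} {A : cstarType R}.
Implicit Types a b x : A.

Lemma cmul_suml (I : Type) (r : seq I) (P : pred I) (F : I -> A) b :
  cmul (\sum_(i <- r | P i) F i) b = \sum_(i <- r | P i) cmul (F i) b.
Proof. by apply: (@morphD_sum _ _ (cmul^~ b)) => x y; rewrite cmulDl. Qed.

Lemma cmul_sumr (I : Type) (r : seq I) (P : pred I) (F : I -> A) a :
  cmul a (\sum_(i <- r | P i) F i) = \sum_(i <- r | P i) cmul a (F i).
Proof. by apply: (@morphD_sum _ _ (cmul a)) => x y; rewrite cmulDr. Qed.

Lemma cstar_sum (I : Type) (r : seq I) (P : pred I) (F : I -> A) :
  cstar (\sum_(i <- r | P i) F i) = \sum_(i <- r | P i) cstar (F i).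
Proof. by apply: (@morphD_sum _ _ (@cstar R A)) => x y; rewrite cstarD. Qed.

Lemma cmulBl a b x : cmul (a - b) x = cmul a x - cmul b x.
Proof.
by rewrite cmulDl (@morphDN _ _ (cmul^~ x)) // => y z; rewrite cmulDl.
Qed.

Lemma cmulBr a b x : cmul x (a - b) = cmul x a - cmul x b.
Proof.
by rewrite cmulDr (@morphDN _ _ (cmul x)) // => y z; rewrite cmulDr.
Qed.

Lemma cstarB a b : cstar (a - b) = cstar a - cstar b.
Proof.
by rewrite cstarD (@morphDN _ _ (@cstar R A)) // => y z; rewrite cstarD.
Qed.

Lemma cstar_identity (e : A) : is_identity e -> cstar e = e.
Proof.
move=> eP; have [_ ee] := eP (cstar e).
by rewrite -[RHS]cstarK -[X in _ = cstar X]ee cstarM cstarK ee.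
Qed.

Lemma cstar_cpos a : cpos a -> cstar a = a.
Proof. by case=> x ->; rewrite cstarM cstarK. Qed.

Lemma cpos_cmul x : cpos (cmul (cstar x) x).
Proof. by exists x. Qed.

(** The (i, i) entry of 1 = p^* p + (1 - p)^* (1 - p) for a self-adjoint
    projection p, with q = 1 - p.  The equation p = p^* p contains both
    self-adjointness and idempotency, as its right-hand side is self-adjoint. *)
Lemma identity_sum_projection (one : A) (n : nat) (p : 'M[A]_n) i :
    is_identity one ->
    (forall i j, p i j = \sum_k cmul (cstar (p k i)) (p k j)) ->
  let q := \matrix_(i, j) ((if i == j then one else 0) - p i j) in
  one = \sum_k cmul (cstar (p k i)) (p k i)
        + \sum_k cmul (cstar (q k i)) (q k i).
Proof.
move=> oneP pP q.
have one_mul a : cmul one a = a by case: (oneP a).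
have mul_one a : cmul a one = a by case: (oneP a).
have pstar : cstar (p i i) = p i i.
  rewrite {1}pP cstar_sum [RHS]pP; apply: eq_bigr => k _.
  by rewrite cstarM cstarK.
have qi k : k != i -> cmul (cstar (q k i)) (q k i) =
    cmul (cstar (p k i)) (p k i).
  (* Off the diagonal q is - p, and the two signs cancel. *)
  move=> ki; rewrite mxE (negPf ki) sub0r.
  rewrite -[- p k i]scaleN1r cstarZ cmulZl cmulZr scalerA.
  by rewrite rmorphN1 mulrNN mulr1 scale1r.
rewrite [X in _ + X](bigD1 i) //= (eq_bigr _ qi) mxE eqxx.
rewrite cstarB (cstar_identity one oneP) pstar cmulBl !cmulBr !one_mul mul_one.
have := pP i i; rewrite (bigD1 i) //= pstar.
set S := \sum_(_ < n | _) _; set s := cmul (p i i) (p i i) => pii.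
have -> : S = p i i - s by apply: (addrI s); rewrite -pii [RHS]addrC subrK.
by rewrite [s + _]addrC !subrK addrC subrK.
Qed.

End CStar.

(** * Traces on the positive cone *)

Section Trace.
Context {R : realType} {A : cstarType R} {tau : A -> \bar R}.
Hypothesis tauP : is_lsc_trace tau.

Lemma tr_sum_fin (I : finType) (a : I -> A) : (forall i, cpos (a i)) ->
  tau (\sum_i a i) = (\sum_i tau (a i))%E.
Proof.
move=> aP; rewrite [X in tau X]big_enum_val.
rewrite (tr_sum tauP) //.
by rewrite [RHS]big_enum_val.
Qed.

(** Self-adjointness of the sum of the c j kills the imaginary part of the
    decompositions of the a i, leaving the sum of the c j equal to a difference
    x0 - x2 of sums of positive elements of finite trace.  Moving x2 to the left
    makes both sides sums of finite families of positive elements, where tau is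
    additive; finiteness then allows subtracting the traces of x2 again. *)
Lemma tr_ext_sum (I J : finType) (a : I -> A) (z : I -> R[i]) (c : J -> A) :
    (forall i, tr_ext tau (a i) (z i)) -> (forall j, cpos (c j)) ->
    \sum_j c j = \sum_i a i ->
  (\sum_j tau (c j))%E = (complex.Re (\sum_i z i))%:E.
Proof.
move=> /choice[p pP] cP cE.
have pp i m : cpos (p i m) by case: (pP i) => /(_ m)[].
have ptau i m : tau (p i m) = (fine (tau (p i m)))%:E.
  case: (pP i) => /(_ m)[pim ltoo] _ _; rewrite fineK// ge0_fin_numE//.
  exact: tr_ge0.
have i2 : 'i ^+ 2 = -1 :> R[i] by rewrite sqrCi.
have i3 : 'i ^+ 3 = - 'i :> R[i] by rewrite exprS i2 mulrN1.
pose o0 : 'I_4 := @Ordinal 4 0 isT; pose o1 : 'I_4 := @Ordinal 4 1 isT.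
pose o2 : 'I_4 := @Ordinal 4 2 isT; pose o3 : 'I_4 := @Ordinal 4 3 isT.
have sum4 (V : zmodType) (F : 'I_4 -> V) :
    \sum_m F m = F o0 + F o1 + F o2 + F o3.
  rewrite !big_ord_recr big_ord0 /= add0r.
  by congr (F _ + F _ + F _ + F _); apply: val_inj.
pose x m := \sum_i p i m.
have xstar m : cstar (x m) = x m.
  by rewrite cstar_sum; apply: eq_bigr => i _; exact: cstar_cpos.
have aE : \sum_i a i = (x o0 - x o2) + 'i *: (x o1 - x o3).
  under eq_bigr => i _.
    have [_ -> _] := pP i.
    rewrite sum4 /= expr0 expr1 i2 i3 scale1r scaleN1r scaleNr.
    over.
  rewrite !big_split /= !sumrN -!scaler_sumr scalerBr.
  by rewrite -[LHS]addrA [LHS]addrACA.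
have sumE : \sum_j c j = x o0 - x o2.
  (* With 'i v the imaginary part, - 'i v = 'i v, hence 'i v = 0. *)
  have : cstar (\sum_j c j) = \sum_j c j.
    by rewrite cstar_sum; apply: eq_bigr => j _; exact: cstar_cpos.
  rewrite cE aE cstarD cstarZ !cstarB !xstar conjCi scaleNr => /addrI/eqP.
  rewrite eq_sym -addr_eq0 -mulr2n -scaler_nat scaler_eq0 pnatr_eq0 /=.
  by move=> /eqP ->; rewrite addr0.
have : tau (\sum_(s : J + I) match s with inl j => c j | inr i => p i o2 end)
     = tau (x o0).
  by congr tau; rewrite big_sumType /= sumE subrK.
rewrite tr_sum_fin; last by case.
rewrite big_sumType /= [RHS]tr_sum_fin//.
under [X in (_ + X)%E]eq_bigr do rewrite ptau.
under [RHS]eq_bigr do rewrite ptau.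
rewrite !sumEFin => H.
rewrite -[LHS](@addeK _ (\sum_i fine (tau (p i o2)))%:E) // H -EFinB.
congr EFin.
rewrite (raddf_sum (@complex.Re R)) /= -sumrB.
apply: eq_bigr => i _; have [_ _ ->] := pP i.
rewrite sum4 [_ ^+ o0]expr0 [_ ^+ o1]expr1 [_ ^+ o2]i2 [_ ^+ o3]i3.
rewrite -complexiE mul1r mulN1r mulNr /=.
by rewrite !(mul0r, mul1r, mulr0, subr0, addr0).
Qed.

End Trace.

(** * Equivalence bimodules *)

Section Bimodule.
Context {R : realType} {A B : cstarType R} {E : equivalence_bimodule A B}.

Lemma lact_suml (I : Type) (r : seq I) (P : pred I) (F : I -> A) (f : E) :
  lact (\sum_(i <- r | P i) F i) f = \sum_(i <- r | P i) lact (F i) f.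
Proof.
rewrite (@morphD_sum A E (fun x => lact x f)) // => x y.
by rewrite (lactDl (eb_left E)).
Qed.

Lemma lact_sumr (I : Type) (r : seq I) (P : pred I) (F : I -> E) (a : A) :
  lact a (\sum_(i <- r | P i) F i) = \sum_(i <- r | P i) lact a (F i).
Proof.
rewrite (@morphD_sum E E (lact a)) // => x y.
by rewrite (lactDr (eb_left E)).
Qed.

Lemma ract_suml (I : Type) (r : seq I) (P : pred I) (F : I -> E) (b : B) :
  ract (\sum_(i <- r | P i) F i) b = \sum_(i <- r | P i) ract (F i) b.
Proof.
rewrite (@morphD_sum E E (fun x => ract x b)) // => x y.
by rewrite (ractDl (eb_right E)).
Qed.

Lemma ract_sumr (I : Type) (r : seq I) (P : pred I) (F : I -> B) (f : E) :
  ract f (\sum_(i <- r | P i) F i) = \sum_(i <- r | P i) ract f (F i).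
Proof.
rewrite (@morphD_sum B E (ract f)) // => x y.
by rewrite (ractDr (eb_right E)).
Qed.

Lemma lip_suml (I : Type) (r : seq I) (P : pred I) (F : I -> E) (g : E) :
  lip (\sum_(i <- r | P i) F i) g = \sum_(i <- r | P i) lip (F i) g.
Proof.
rewrite (@morphD_sum E A (fun x => lip x g)) // => x y.
by rewrite (lipD (eb_left E)).
Qed.

(** Every inner product annihilates c - one from the left, since
    <f, g> (c - one) = <f, g c> - <f, g> = 0, hence so does their span.  This
    span is dense, so it contains an s at distance less than 1 from one, and then
    c - one = (one - s) (c - one) has norm strictly below itself unless it is
    zero. *)
Lemma ract_fixed (one c : B) : is_identity one ->
  (forall f : E, ract f c = f) -> c = one.
Proof.
move=> oneP cfix.
pose d := c - one.
have ann (s : B) : linear_span [set b | exists f g : E, b = rip f g] s ->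
    cmul s d = 0.
  move=> [k [x [t [tP ->]]]]; rewrite cmul_suml big1 // => i _.
  rewrite cmulZl; have [f [g ->]] := tP i.
  rewrite cmulBr (proj2 (oneP _)) -(rip_act (eb_right E)) cfix subrr.
  by rewrite scaler0.
have [|s [sball sspan]] :=
    rip_full E (O := ball one (1 : R[i])) _ (ball_open _ _).
  by exists one; exact: ballxx.
have dE : cmul (one - s) d = d by rewrite cmulBl (proj1 (oneP _)) ann // subr0.
apply/eqP; rewrite -subr_eq0; apply/negPn/negP => d0.
have dgt0 : 0 < `|d| by rewrite normr_gt0.
have := ler_cnormM (one - s) d; rewrite dE => hle.
have : `|one - s| * `|d| < 1 * `|d|.
  by rewrite ltr_pM2r //; move: sball; rewrite -ball_normE.
by rewrite mul1r => /(le_lt_trans hle); rewrite ltxx.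
Qed.

(** * Matrices over an equivalence bimodule *)

Definition mx_ract {n d : nat} (f : 'M[E]_(n, d)) (b : 'M[B]_d) :
    'M[E]_(n, d) :=
  \matrix_(i < n, j < d) \sum_(k < d) ract (f i k) (b k j).

Definition mx_rip {n d : nat} (f g : 'M[E]_(n, d)) : 'M[B]_d :=
  \matrix_(i < d, j < d) \sum_(k < n) rip (f k i) (g k j).

Section Matrices.
Context {n d : nat}.
Implicit Types f g h : 'M[E]_(n, d).

Lemma mx_lip_rip f g h : mx_lact (mx_lip f g) h = mx_ract f (mx_rip g h).
Proof.
apply/matrixP => i j; rewrite !mxE.
under eq_bigr do rewrite mxE lact_suml.
under [RHS]eq_bigr do rewrite mxE ract_sumr.
rewrite exchange_big; apply: eq_bigr => k _; apply: eq_bigr => l _.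
exact: lip_rip.
Qed.

Lemma mx_lractA (a : 'M[A]_n) f (b : 'M[B]_d) :
  mx_lact a (mx_ract f b) = mx_ract (mx_lact a f) b.
Proof.
apply/matrixP => i j; rewrite !mxE.
under eq_bigr do rewrite mxE lact_sumr.
under [RHS]eq_bigr do rewrite mxE ract_suml.
rewrite exchange_big; apply: eq_bigr => k _; apply: eq_bigr => l _.
by rewrite lractA.
Qed.

Lemma mx_lip_star f g i j : cstar (mx_lip f g i j) = mx_lip g f j i.
Proof.
rewrite !mxE cstar_sum; apply: eq_bigr => k _.
exact: (lip_star (eb_left E)).
Qed.

Lemma mx_rip_star f g i j : cstar (mx_rip f g i j) = mx_rip g f j i.
Proof.
rewrite !mxE cstar_sum; apply: eq_bigr => k _.
exact: (rip_star (eb_right E)).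
Qed.

Lemma mx_lip_lact (a : 'M[A]_n) f g i j :
  mx_lip (mx_lact a f) g i j = \sum_k cmul (a i k) (mx_lip f g k j).
Proof.
rewrite mxE; under eq_bigr do rewrite mxE lip_suml.
rewrite exchange_big; apply: eq_bigr => k _; rewrite mxE cmul_sumr.
by apply: eq_bigr => l _; rewrite (lip_act (eb_left E)).
Qed.

(** In the form f |-> f [g, g]' the frame operator acts on the side opposite to
    M_n(A). *)
Lemma frame_operator_lact (a : 'M[A]_n) f g :
  frame_operator g (mx_lact a f) = mx_lact a (frame_operator g f).
Proof. by rewrite /frame_operator !mx_lip_rip mx_lractA. Qed.

(** Both f [g, h]' = [f, g] h and f are sent to [f, g] g by the frame
    operator. *)
Lemma dual_window_reconstruction f g h : injective (frame_operator g) ->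
  frame_operator g h = g -> mx_ract f (mx_rip g h) = f.
Proof.
by move=> ginj hE; apply: ginj; rewrite -mx_lip_rip frame_operator_lact hE.
Qed.

(** Reconstruction of a matrix with all entries f in column j and 0 elsewhere
    says that the (j, j) entry of [g, h]' fixes f.  The index i0 provides a row
    in which to read this off. *)
Lemma dual_window_biorthogonal (one : B) g h (i0 : 'I_n) j :
    is_identity one -> injective (frame_operator g) ->
    frame_operator g h = g -> mx_rip g h j j = one.
Proof.
move=> oneP ginj hE; apply: ract_fixed => // f.
pose F : 'M[E]_(n, d) := \matrix_(i, k) (if k == j then f else 0).
have /matrixP/(_ i0 j) := dual_window_reconstruction F g h ginj hE.
rewrite mxE (bigD1 j) //= big1 => [|k /negPf kj]; last first.
  rewrite mxE kj; apply: (@morphD0 E E (fun x => ract x _)) => x y.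
  exact: (ractDl (eb_right E)).
by rewrite addr0 !mxE eqxx.
Qed.

(** Since g = [h, g] g, linearity in the first argument gives
    [g, h] = [h, g] [g, h], and [h, g] is the adjoint of [g, h]. *)
Lemma dual_window_lip_projection g h i j : frame_operator g h = g ->
  mx_lip g h i j = \sum_k cmul (cstar (mx_lip g h k i)) (mx_lip g h k j).
Proof.
move=> hE; rewrite -{1}hE mx_lip_lact.
by apply: eq_bigr => k _; rewrite mx_lip_star.
Qed.
End Matrices.
End Bimodule.

(** * The density inequality *)

Theorem theorem3p28 (R : realType) (n d : nat) (hn : (0 < n)%N) (hd : (0 < d)%N)
    (G : left_gabor_bimodule R) (oneA : gbA G) (hA : is_identity oneA)
    (trA : gbA G -> \bar R) (htrA : is_induced_trace trA)
    (g : 'M[gbE G]_(n, d)) (hg : bijective (frame_operator g)) :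
  ((d%:R * complex.Re (gb_trB (gb1B G)))%:E <= n%:R%:E * trA oneA)%E.
Proof.
have ginj : injective (frame_operator g) := bij_inj hg.
have [S _ frameS] := hg; pose h := S g.
have hE : frame_operator g h = g by exact: frameS.
have [trAP trA_ext] := htrA.
pose p : 'M[gbA G]_n := mx_lip g h.
have pP i j : p i j = \sum_k cmul (cstar (p k i)) (p k j).
  exact: dual_window_lip_projection.
(* The q_ki^* q_ki have nonnegative trace, so dropping them from the
   decomposition of the identity can only decrease the trace. *)
have trace_p_le i :
    (\sum_k trA (cmul (cstar (p k i)) (p k i)) <= trA oneA)%E.
  pose q := \matrix_(i, j) ((if i == j then oneA else 0) - p i j).
  have -> : oneA = \sum_(s : 'I_n + 'I_n)
      match s with
      | inl k => cmul (cstar (p k i)) (p k i)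
      | inr k => cmul (cstar (q k i)) (q k i)
      end by rewrite big_sumType; exact: identity_sum_projection.
  rewrite (tr_sum_fin trAP) => [|[]k]; [|exact: cpos_cmul..].
  rewrite big_sumType /= leeDl // sume_ge0 // => k _.
  apply: (tr_ge0 trAP); exact: cpos_cmul.
(* The trace of p = [g, h] is that of [h, g]', whose diagonal entries are 1. *)
have trace_pE : (\sum_i \sum_k trA (cmul (cstar (p k i)) (p k i)))%E =
    (d%:R * complex.Re (gb_trB (gb1B G)))%:E.
  rewrite pair_big /=.
  rewrite (@tr_ext_sum _ _ _ trAP ('I_n * 'I_d)%type _
    (fun ij => lip (g ij.1 ij.2) (h ij.1 ij.2))
    (fun ij => gb_trB (rip (h ij.1 ij.2) (g ij.1 ij.2)))) //=.
  - congr EFin.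
    rewrite -(pair_big xpredT xpredT
      (fun i j => gb_trB (rip (h i j) (g i j)))) /=.
    rewrite exchange_big /=.
    have diag j : \sum_i gb_trB (rip (h i j) (g i j)) = gb_trB (gb1B G).
      rewrite -(morphD_sum _ _ _ (ftrD (gb_trBP G))).
      rewrite -(cstar_identity _ (@gb1BP _ G)).
      rewrite -(dual_window_biorthogonal _ g h (Ordinal hn) j (@gb1BP _ G)) //.
      by rewrite mx_rip_star mxE.
    rewrite (eq_bigr _ (fun j _ => diag j)) sumr_const card_ord.
    by rewrite raddfMn mulr_natl.
  - by move=> ik; exact: cpos_cmul.
  - rewrite -(pair_big xpredT xpredT
      (fun i k => cmul (cstar (p k i)) (p k i))) /=.
    rewrite -(pair_big xpredT xpredT
      (fun i j => lip (g i j) (h i j))) /=.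
    by apply: eq_bigr => i _; rewrite -pP mxE.
have -> : (n%:R%:E * trA oneA = \sum_(i < n) trA oneA)%E.
  by rewrite big_const_ord iter_addr addr0 mule_natl.
rewrite -trace_pE.
by apply: lee_sum => i _; exact: trace_p_le.
Qed.
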